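(* Let $F$ be a number field. For the Bost-Connes system of $F$ one has $\mathrm{Inn}=\mathcal{O}_F^\natural:=\mathcal{O}_F\setminus\{0\}$, and the outer symmetry semigroup $\mathrm{Out}$ acts on the algebra $\mathcal{H}_F$ through the group $\pi_0(F^\times\backslash\mathbb{A}_F^\times)$; that is, the action of $\mathrm{Sym}$ on $\mathcal{H}_F$, taken modulo $\mathrm{Inn}$, factors through the natural homomorphism $\mathrm{Sym}\to\mathrm{Out}\to\pi_0(F^\times\backslash\mathbb{A}_F^\times)$.
   Context: Let $G=\mathrm{Res}_{F/\mathbb{Q}}\mathbb{G}_{m,F}$, $F_{\mathbb R}=F\otimes_{\mathbb Q}\mathbb{R}$, $G(\mathbb{R})=F_{\mathbb R}^\times$, $X_F=G(\mathbb{R})/G(\mathbb{R})^+=\pi_0(G(\mathbb{R}))$. $\mathbb{A}_F=\mathbb{A}_{f,F}\times F_{\mathbb R}$ is the adele ring, $\widehat{\mathcal{O}}_F\subset\mathbb{A}_{f,F}$ the profinite completion of $\mathcal{O}_F$, and $\widehat{\mathcal{O}}_F^\natural:=\widehat{\mathcal{O}}_F\cap \mathbb{A}_{f,F}^\times$. The Shimura variety is $\mathrm{Sh}:=\varprojlim_{K'}F^\times\backslash (X_F\times\mathbb{A}_{f,F}^\times)/K'$, over compact open subgroups $K'\subset\mathbb{A}_{f,F}^\times$, with points written $[z,l]$ (it is isomorphic to $\pi_0(F^\times\backslash\mathbb{A}_F^\times)$). Put $Y_F=\widehat{\mathcal{O}}_F\times\mathrm{Sh}$, and let $U_F\subset\mathbb{A}_{f,F}^\times\times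 Y_F$ be the set of $(g,\rho,[z,l])$ with $g\rho\in\widehat{\mathcal{O}}_F$. The group $(\widehat{\mathcal{O}}_F^\times)^2$ acts on $U_F$ by $(\gamma_1,\gamma_2)\cdot(g,\rho,[z,l])=(\gamma_1g\gamma_2^{-1},\gamma_2\rho,[z,l\gamma_2^{-1}])$; let $Z_F$ be the quotient space. $\mathcal{H}_F:=C_c(Z_F)$ is the space of compactly supported continuous functions on $Z_F$, regarded as invariant functions on $U_F$, with convolution product $(f_1*f_2)(g,y)=\sum_{h\in\widehat{\mathcal{O}}_F^\times\backslash\mathbb{A}_{f,F}^\times,\ hy\in Y_F}f_1(gh^{-1},hy)f_2(h,y)$, where $h\cdot(\rho,[z,l])=(h\rho,[z,lh^{-1}])$ (and $hy\in Y_F$ means $h\rho\in\widehat{\mathcal O}_F$). The symmetry semigroup is $\mathrm{Sym}:=\widehat{\mathcal{O}}_F^\natural\times F_{\mathbb R}^\times$, acting on $\mathcal{H}_F$ by $\theta_{(m,c)}(f)(g,\rho,[z,l])=f(g,\rho m,[cz,l])$. The subsemigroup $\mathrm{Inn}\subset\mathrm{Sym}$ is $\mathrm{Inn}:=F^\times\cap\widehat{\mathcal{O}}_F$ (intersection inside $\mathbb{A}_{f,F}$; in the general formalism, $C(\mathbb Q)\cap\phi^{-1}(\text{center of }K_M)$ with $C$ the center of $G$ and $K_M=\widehat{\mathcal O}_F$), embedded diagonally in $\mathrm{Sym}$; and $\mathrm{Out}:=\mathrm{Inn}\backslash\mathrm{Sym}$. The natural homomorphism $\mathrm{Sym}\to\pi_0(F^\times\backslash\mathbb{A}_F^\times)$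 sends $(m,c)$ to the class of the idele with finite part $m$ and archimedean part $c$; it is trivial on $\mathrm{Inn}$. Saying that the action modulo $\mathrm{Inn}$ factors through this homomorphism means: if $s,s'\in\mathrm{Sym}$ have the same image in $\pi_0(F^\times\backslash\mathbb{A}_F^\times)$, then there are $n,n'\in\mathrm{Inn}$ with $\theta_{ns}=\theta_{n's'}$. *)

(* Defs.v *)
From HB Require Import structures.
From mathcomp Require Import all_boot all_order all_algebra all_field.
From mathcomp Require Import all_classical all_reals all_analysis.
From mathcomp Require Import complex ring.
From Stdlib Require Import Relation_Operators.
Set Implicit Arguments.
Unset Strict Implicit.
Unset Printing Implicit Defensive.
Import Order.TTheory GRing.Theory Num.Theory.
Import numFieldNormedType.Exports.
Local Open Scope quotient_scope.
Local Open Scope classical_set_scope.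
Local Open Scope ring_scope.

(* The quotient of T by the equivalence relation generated by r; orbit spaces
   of group or semigroup actions are obtained with r x y := "y = g x for some
   g". *)
Section QuotBy.
Variables (T : choiceType) (r : T -> T -> Prop).

Definition gen_eqv (x y : T) : bool := `[< clos_refl_sym_trans T r x y >].

Lemma gen_eqv_equiv : equiv_class_of gen_eqv.
Proof.
split=> [x|x y|y x z]; first by apply/asboolP; exact: rst_refl.
  by apply/asboolP/asboolP; exact: rst_sym.
by move=> /asboolP xy /asboolP yz; apply/asboolP; exact: rst_trans xy yz.
Qed.
Canonical gen_eqv_equivRel := EquivRelPack gen_eqv_equiv.
Canonical gen_eqv_encModRel := defaultEncModRel gen_eqv.

Definition quot_by : Type := {eq_quot gen_eqv}.
HB.instance Definition _ := Choice.on quot_by.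
HB.instance Definition _ : EqQuotient T gen_eqv quot_by :=
  EqQuotient.on quot_by.

Lemma quot_byP x y : x = y %[mod quot_by] <-> clos_refl_sym_trans T r x y.
Proof.
split=> [/eqP|xy]; first by rewrite eqmodE => /asboolP.
by apply/eqP; rewrite eqmodE; apply/asboolP.
Qed.
End QuotBy.

Lemma quot_by_map (T U : choiceType) (r : T -> T -> Prop) (s : U -> U -> Prop)
    (h : T -> U) : (forall x y, r x y -> s (h x) (h y)) ->
  forall x y, x = y %[mod quot_by r] -> h x = h y %[mod quot_by s].
Proof.
move=> rs x y /quot_byP xy; apply/quot_byP; elim: xy => {x y}.
- by move=> x y /rs; exact: rst_step.
- by move=> x; exact: rst_refl.
- by move=> x y _; exact: rst_sym.
- by move=> x y z _ xy _; exact: rst_trans.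
Qed.

Definition tquot_by (T : topologicalType) (r : T -> T -> Prop) : Type :=
  quotient_topology (quot_by r).
HB.instance Definition _ (T : topologicalType) (r : T -> T -> Prop) :=
  Topological.on (tquot_by r).
HB.instance Definition _ (T : topologicalType) (r : T -> T -> Prop) :=
  Quotient.on (tquot_by r).

Lemma tquot_byP (T : topologicalType) (r : T -> T -> Prop) x y :
  x = y %[mod tquot_by r] <-> clos_refl_sym_trans T r x y.
Proof. exact: quot_byP. Qed.

(* the set of connected components *)
Definition pi0 (T : topologicalType) : Type :=
  quot_by (fun x y : T => connected_component [set: T] x y).
HB.instance Definition _ (T : topologicalType) := Choice.on (pi0 T).
HB.instance Definition _ (T : topologicalType) := Quotient.on (pi0 T).

(* Join of the two structures, without compatibility axiom. *)
#[short(type="topComPzRingType")]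
HB.structure Definition TopComPzRing :=
  {A of GRing.ComPzRing A & Topological A}.

HB.instance Definition _ (A B : topComPzRingType) :=
  GRing.ComPzRing.on (A * B)%type.

(* The unit group of A, as the set of pairs (x, x^-1); for a topological ring
   it carries the topology induced from A * A, not the one induced from A. *)
Section Units.
Variable A : comPzRingType.

Definition units : Type := set_type [set p : A * A | p.1 * p.2 = 1].
HB.instance Definition _ := Choice.on units.

Implicit Types u v : units.
Definition uval u : A := (set_val u).1.
Definition uinv u : A := (set_val u).2.

Lemma uvalK u : uval u * uinv u = 1.
Proof. exact: (set_valP u). Qed.

Definition mk_unit (x y : A) (xy : x * y = 1) : units :=
  exist _ (x, y) (mem_set xy).

Lemma uval_inj : injective uval.
Proof.
move=> [[x y] p] [[x' y'] p'] /= xx'; apply: val_inj => /=.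
have := set_mem p; have := set_mem p'.
rewrite /uval /= in xx' => /=; rewrite -xx' => xy' xy.
by rewrite -[y]mulr1 -xy' mulrA [y * x]mulrC xy mul1r.
Qed.

Fact unit_one_subproof : 1 * 1 = 1 :> A. Proof. exact: mulr1. Qed.
Fact unit_mul_subproof u v : (uval u * uval v) * (uinv u * uinv v) = 1.
Proof. by rewrite mulrACA !uvalK mulr1. Qed.
Fact unit_inv_subproof u : uinv u * uval u = 1.
Proof. by rewrite mulrC uvalK. Qed.

Definition unit_one : units := mk_unit unit_one_subproof.
Definition unit_mul u v : units := mk_unit (unit_mul_subproof u v).
Definition unit_inv u : units := mk_unit (unit_inv_subproof u).

Fact unit_mulA : associative unit_mul.
Proof. by move=> u v w; apply: uval_inj; exact: mulrA. Qed.
Fact unit_mulC : commutative unit_mul.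
Proof. by move=> u v; apply: uval_inj; exact: mulrC. Qed.
Fact unit_mul1 : left_id unit_one unit_mul.
Proof. by move=> u; apply: uval_inj; exact: mul1r. Qed.
Fact unit_mulr1 : right_id unit_one unit_mul.
Proof. by move=> u; apply: uval_inj; exact: mulr1. Qed.
Fact unit_mulV : left_inverse unit_one unit_inv unit_mul.
Proof. by move=> u; apply: uval_inj; exact: unit_inv_subproof. Qed.
Fact unit_mulrV : right_inverse unit_one unit_inv unit_mul.
Proof. by move=> u; apply: uval_inj; exact: uvalK. Qed.

HB.instance Definition _ := isGroup.Build units
  unit_mulA unit_mul1 unit_mulr1 unit_mulV unit_mulrV.

Lemma unitC (u v : units) : (u * v = v * u)%g.
Proof. exact: unit_mulC. Qed.
End Units.

HB.instance Definition _ (A : topComPzRingType) := Topological.on (units A).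

Section UnitsMap.
Variables (A B : comPzRingType) (f : {rmorphism A -> B}).
Fact umap_subproof (u : units A) : f (uval u) * f (uinv u) = 1.
Proof. by rewrite -rmorphM uvalK rmorph1. Qed.
Definition umap (u : units A) : units B := mk_unit (umap_subproof u).
End UnitsMap.

(* A / (n+1)A; the shift keeps the modulus positive. *)
Section QuotInt.
Variables (A : comPzRingType) (n : nat).

Definition modq : Type := quot_by (fun x y : A => exists z, y = x + z *+ n.+1).
HB.instance Definition _ := Choice.on modq.
HB.instance Definition _ := Quotient.on modq.

Lemma modqP (x y : A) :
  (x = y %[mod modq]) <-> exists z, y = x + z *+ n.+1.
Proof.
split=> [/quot_byP|xy]; last by apply/quot_byP; exact: rst_step.
elim=> [//|{}x|{}x {}y _ [z ->]|{}x {}y t _ [z ->] _ [z' ->]].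
- by exists 0; rewrite mul0rn addr0.
- by exists (- z); rewrite mulNrn addrK.
- by exists (z + z'); rewrite mulrnDl addrA.
Qed.

Definition modq_add (p q : modq) : modq := \pi_modq (repr p + repr q).
Definition modq_opp (p : modq) : modq := \pi_modq (- repr p).
Definition modq_mul (p q : modq) : modq := \pi_modq (repr p * repr q).

Lemma modqE (p : modq) : p = \pi_modq (repr p).
Proof. by rewrite reprK. Qed.

Lemma modq_repr (x : A) : exists z, repr (\pi_modq x) = x + z *+ n.+1.
Proof. by apply/modqP; rewrite reprK. Qed.

Lemma modq_addE x y : modq_add (\pi_modq x) (\pi_modq y) = \pi_modq (x + y).
Proof.
apply/esym/modqP; have [a ->] := modq_repr x; have [b ->] := modq_repr y.
by exists (a + b); rewrite mulrnDl addrACA.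
Qed.

Lemma modq_oppE x : modq_opp (\pi_modq x) = \pi_modq (- x).
Proof.
apply/esym/modqP; have [a ->] := modq_repr x.
by exists (- a); rewrite opprD mulNrn.
Qed.

Lemma modq_mulE x y : modq_mul (\pi_modq x) (\pi_modq y) = \pi_modq (x * y).
Proof.
apply/esym/modqP; have [a ->] := modq_repr x; have [b ->] := modq_repr y.
exists (x * b + a * y + a * b *+ n.+1).
by rewrite mulrDl !mulrDr !mulrnDl !mulrnAl !mulrnAr -!addrA.
Qed.

Fact modq_addA : associative modq_add.
Proof.
by move=> p q s; rewrite (modqE p) (modqE q) (modqE s) !modq_addE addrA.
Qed.
Fact modq_addC : commutative modq_add.
Proof. by move=> p q; rewrite (modqE p) (modqE q) !modq_addE addrC. Qed.
Fact modq_add0 : left_id (\pi_modq 0) modq_add.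
Proof. by move=> p; rewrite (modqE p) modq_addE add0r. Qed.
Fact modq_addN : left_inverse (\pi_modq 0) modq_opp modq_add.
Proof. by move=> p; rewrite (modqE p) modq_oppE modq_addE addNr. Qed.
HB.instance Definition _ := GRing.isZmodule.Build modq
  modq_addA modq_addC modq_add0 modq_addN.

Fact modq_mulA : associative modq_mul.
Proof.
by move=> p q s; rewrite (modqE p) (modqE q) (modqE s) !modq_mulE mulrA.
Qed.
Fact modq_mulC : commutative modq_mul.
Proof. by move=> p q; rewrite (modqE p) (modqE q) !modq_mulE mulrC. Qed.
Fact modq_mul1 : left_id (\pi_modq 1) modq_mul.
Proof. by move=> p; rewrite (modqE p) modq_mulE mul1r. Qed.
Fact modq_mulDl : left_distributive modq_mul modq_add.
Proof.
move=> p q s; rewrite (modqE p) (modqE q) (modqE s).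
by rewrite !(modq_addE, modq_mulE) mulrDl.
Qed.
HB.instance Definition _ := GRing.Zmodule_isComPzRing.Build modq
  modq_mulA modq_mulC modq_mul1 modq_mulDl.

Lemma pi_modqD x y : \pi_modq (x + y) = \pi_modq x + \pi_modq y.
Proof. exact/esym/modq_addE. Qed.
Lemma pi_modqN x : \pi_modq (- x) = - \pi_modq x.
Proof. exact/esym/modq_oppE. Qed.
Lemma pi_modqM x y : \pi_modq (x * y) = \pi_modq x * \pi_modq y.
Proof. exact/esym/modq_mulE. Qed.
End QuotInt.

(* The completion lim_n A/nA. When A is the ring of integers of a number field
   this is its profinite completion, the ideals nA being cofinal among those of
   finite index. *)
Section Hat.
Variable A : comPzRingType.

Definition modq_prod : Type :=
  prod_topology (fun n => discrete_topology (modq A n)).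
HB.instance Definition _ := Topological.on modq_prod.

Definition coherent (x : modq_prod) : Prop :=
  forall m n : nat, (m.+1 %| n.+1)%N ->
  forall a : A, x n = \pi_(modq A n) a -> x m = \pi_(modq A m) a.

Definition hat : Type := set_type coherent.
HB.instance Definition _ := Topological.on hat.

Definition hproj (n : nat) (x : hat) : modq A n := set_val x n.

Definition mk_hat (x : forall n, modq A n) (cx : coherent x) : hat :=
  exist _ (x : modq_prod) (mem_set cx).

Lemma hatP (x y : hat) : (forall n, hproj n x = hproj n y) -> x = y.
Proof. by move=> xy; apply/val_inj/functional_extensionality_dep. Qed.

Lemma hat_coherent (x : hat) : coherent (set_val x).
Proof. exact: set_valP. Qed.

Lemma hat_repr (x : hat) m n : (m.+1 %| n.+1)%N ->
  hproj m x = \pi_(modq A m) (repr (hproj n x)).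
Proof. by move=> mn; apply: hat_coherent mn _ _; rewrite reprK. Qed.

Fact modq_sub m n (a b : A) : (m.+1 %| n.+1)%N ->
  a = b %[mod modq A n] -> a = b %[mod modq A m].
Proof.
move=> /dvdnP[k kE] /modqP[z ->]; apply/modqP; exists (z *+ k).
by rewrite -mulrnA -kE.
Qed.

Fact hat_cst_subproof (a : A) : coherent (fun n => \pi_(modq A n) a).
Proof. by move=> m n mn b; exact: modq_sub. Qed.
Fact hat_add_subproof (x y : hat) :
  coherent (fun n => hproj n x + hproj n y : modq A n).
Proof.
move=> m n mn a /=; rewrite !(hat_repr _ mn).
move: (hproj n x) (hproj n y) => p q; rewrite {1}(modqE p) {1}(modqE q).
by rewrite -!pi_modqD; exact: modq_sub.
Qed.
Fact hat_opp_subproof (x : hat) : coherent (fun n => - hproj n x : modq A n).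
Proof.
move=> m n mn a /=; rewrite !(hat_repr _ mn).
by move: (hproj n x) => p; rewrite {1}(modqE p) -!pi_modqN; exact: modq_sub.
Qed.
Fact hat_mul_subproof (x y : hat) :
  coherent (fun n => hproj n x * hproj n y : modq A n).
Proof.
move=> m n mn a /=; rewrite !(hat_repr _ mn).
move: (hproj n x) (hproj n y) => p q; rewrite {1}(modqE p) {1}(modqE q).
by rewrite -!pi_modqM; exact: modq_sub.
Qed.

Definition hat_of (a : A) : hat := mk_hat (@hat_cst_subproof a).
Definition hat_add x y := mk_hat (@hat_add_subproof x y).
Definition hat_opp x := mk_hat (@hat_opp_subproof x).
Definition hat_mul x y := mk_hat (@hat_mul_subproof x y).

Fact hat_addA : associative hat_add.
Proof. by move=> x y z; apply: hatP => n; exact: addrA. Qed.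
Fact hat_addC : commutative hat_add.
Proof. by move=> x y; apply: hatP => n; exact: addrC. Qed.
Fact hat_add0 : left_id (hat_of 0) hat_add.
Proof. by move=> x; apply: hatP => n; exact: add0r. Qed.
Fact hat_addN : left_inverse (hat_of 0) hat_opp hat_add.
Proof. by move=> x; apply: hatP => n; exact: addNr. Qed.
HB.instance Definition _ := GRing.isZmodule.Build hat
  hat_addA hat_addC hat_add0 hat_addN.

Fact hat_mulA : associative hat_mul.
Proof. by move=> x y z; apply: hatP => n; exact: mulrA. Qed.
Fact hat_mulC : commutative hat_mul.
Proof. by move=> x y; apply: hatP => n; exact: mulrC. Qed.
Fact hat_mul1 : left_id (hat_of 1) hat_mul.
Proof. by move=> x; apply: hatP => n; exact: mul1r. Qed.
Fact hat_mulDl : left_distributive hat_mul hat_add.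
Proof. by move=> x y z; apply: hatP => n; exact: mulrDl. Qed.
HB.instance Definition _ := GRing.Zmodule_isComPzRing.Build hat
  hat_mulA hat_mulC hat_mul1 hat_mulDl.

Fact hat_of_is_zmod_morphism : zmod_morphism hat_of.
Proof.
move=> a b; apply: hatP => n.
have -> : hproj n (hat_of (a - b)) = \pi_(modq A n) (a - b) by [].
by rewrite pi_modqD pi_modqN.
Qed.
Fact hat_of_is_monoid_morphism : monoid_morphism hat_of.
Proof. by split=> // a b; apply: hatP => n; exact: pi_modqM. Qed.
HB.instance Definition _ :=
  GRing.isZmodMorphism.Build A hat hat_of hat_of_is_zmod_morphism.
HB.instance Definition _ :=
  GRing.isMonoidMorphism.Build A hat hat_of hat_of_is_monoid_morphism.
End Hat.

(* A tensor Q, as the localization of A at the positive integers: the pair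
   (x, d) stands for x / (d+1). For A topological the topology is that of the
   union of the subsets A / (d+1), each homeomorphic to A. *)
Section LocQ.
Variable A : topComPzRingType.

Definition locq_rel (p q : A * nat) : Prop :=
  exists t : nat, p.1 *+ q.2.+1 *+ t.+1 = q.1 *+ p.2.+1 *+ t.+1.

Definition locq : Type := tquot_by locq_rel.
HB.instance Definition _ := Topological.on locq.
HB.instance Definition _ := Quotient.on locq.

Lemma locqP (p q : A * nat) : (p = q %[mod locq]) <-> locq_rel p q.
Proof.
split=> [/tquot_byP|pq]; last by apply/tquot_byP; exact: rst_step.
elim=> [//|{}p|{}p {}q _ [t E]|{}p {}q s _ [t E] _ [u E']].
- by exists 0%N.
- by exists t.
- exists (((u.+1 * t.+1) * q.2.+1).-1); rewrite prednK //.
  have := congr1 (fun a => a *+ (u.+1 * s.2.+1)%N) E.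
  have := congr1 (fun a => a *+ (t.+1 * p.2.+1)%N) E'.
  rewrite -!mulrnA => E1 E2.
  transitivity (p.1 *+ (q.2.+1 * (t.+1 * (u.+1 * s.2.+1)))%N).
    by congr (_ *+ _); ring.
  rewrite E2; transitivity (q.1 *+ (s.2.+1 * (u.+1 * (t.+1 * p.2.+1)))%N).
    by congr (_ *+ _); ring.
  by rewrite E1; congr (_ *+ _); ring.
Qed.

Definition frac (x : A) (d : nat) : locq := \pi_locq (x, d).

Lemma fracP x d y e : frac x d = frac y e <->
  exists t : nat, x *+ e.+1 *+ t.+1 = y *+ d.+1 *+ t.+1.
Proof. exact: locqP. Qed.

Lemma fracE (p : locq) : exists x d, p = frac x d.
Proof.
by exists (repr p).1, (repr p).2; rewrite /frac -surjective_pairing reprK.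
Qed.

Lemma frac_repr x d : exists t : nat,
  (repr (frac x d)).1 *+ d.+1 *+ t.+1 = x *+ (repr (frac x d)).2.+1 *+ t.+1.
Proof. by apply/fracP; rewrite /frac -surjective_pairing reprK. Qed.

Definition den_mul (d e : nat) : nat := (d.+1 * e.+1).-1.

Definition locq_add (p q : locq) : locq :=
  let: (x, d) := repr p in let: (y, e) := repr q in
  frac (x *+ e.+1 + y *+ d.+1) (den_mul d e).
Definition locq_opp (p : locq) : locq :=
  let: (x, d) := repr p in frac (- x) d.
Definition locq_mul (p q : locq) : locq :=
  let: (x, d) := repr p in let: (y, e) := repr q in
  frac (x * y) (den_mul d e).

Lemma locq_addE x d y e : locq_add (frac x d) (frac y e) =
  frac (x *+ e.+1 + y *+ d.+1) (den_mul d e).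
Proof.
rewrite /locq_add; have := frac_repr x d; have := frac_repr y e.
case: (repr _) => y' e'; case: (repr _) => x' d' /= [t E] [u E'].
apply/fracP; exists (t.+1 * u.+1).-1; rewrite /den_mul !prednK //.
have := congr1 (fun a => a *+ (u.+1 * d.+1 * d'.+1)%N) E.
have := congr1 (fun a => a *+ (t.+1 * e.+1 * e'.+1)%N) E'.
rewrite !mulrnDl -!mulrnA => E1 E2; congr (_ + _).
- transitivity (x' *+ (d.+1 * (u.+1 * (t.+1 * e.+1 * e'.+1)))%N).
    by congr (_ *+ _); ring.
  by rewrite E1; congr (_ *+ _); ring.
- transitivity (y' *+ (e.+1 * (t.+1 * (u.+1 * d.+1 * d'.+1)))%N).
    by congr (_ *+ _); ring.
  by rewrite E2; congr (_ *+ _); ring.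
Qed.

Lemma locq_oppE x d : locq_opp (frac x d) = frac (- x) d.
Proof.
rewrite /locq_opp; have := frac_repr x d; case: (repr _) => x' d' /= [t E].
by apply/fracP; exists t; rewrite !mulNrn E.
Qed.

Lemma locq_mulE x d y e : locq_mul (frac x d) (frac y e) =
  frac (x * y) (den_mul d e).
Proof.
rewrite /locq_mul; have := frac_repr x d; have := frac_repr y e.
case: (repr _) => y' e'; case: (repr _) => x' d' /= [t E] [u E'].
apply/fracP; exists (t.+1 * u.+1).-1; rewrite /den_mul !prednK //.
have : (x' *+ d.+1 *+ u.+1) * (y' *+ e.+1 *+ t.+1) =
       (x *+ d'.+1 *+ u.+1) * (y *+ e'.+1 *+ t.+1) by rewrite E E'.
rewrite !mulrnAl !mulrnAr -!mulrnA => E2.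
transitivity (x' * y' *+ (d.+1 * (u.+1 * (e.+1 * t.+1)))%N).
  by congr (_ *+ _); ring.
transitivity (x * y *+ (d'.+1 * (u.+1 * (e'.+1 * t.+1)))%N); last first.
  by congr (_ *+ _); ring.
have -> : (d.+1 * (u.+1 * (e.+1 * t.+1)) = e.+1 * (t.+1 * (d.+1 * u.+1)))%N.
  by ring.
have -> : (d'.+1 * (u.+1 * (e'.+1 * t.+1)) = e'.+1 * (t.+1 * (d'.+1 * u.+1)))%N.
  by ring.
exact: E2.
Qed.

Lemma fracW x y d e : x *+ e.+1 = y *+ d.+1 -> frac x d = frac y e.
Proof. by move=> xy; apply/fracP; exists 0%N. Qed.

Fact locq_addA : associative locq_add.
Proof.
move=> p q s; have [x [d ->]] := fracE p; have [y [e ->]] := fracE q.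
have [z [f ->]] := fracE s; rewrite !locq_addE.
apply: fracW; rewrite /den_mul !prednK // !mulrnDl -!mulrnA -!addrA.
by congr (_ *+ _ + (_ *+ _ + _ *+ _)); ring.
Qed.
Fact locq_addC : commutative locq_add.
Proof.
move=> p q; have [x [d ->]] := fracE p; have [y [e ->]] := fracE q.
by rewrite !locq_addE addrC /den_mul mulnC.
Qed.
Fact locq_add0 : left_id (frac 0 0) locq_add.
Proof.
move=> p; have [x [d ->]] := fracE p; rewrite locq_addE.
by apply: fracW; rewrite /den_mul mul1n mul0rn add0r mulr1n.
Qed.
Fact locq_addN : left_inverse (frac 0 0) locq_opp locq_add.
Proof.
move=> p; have [x [d ->]] := fracE p; rewrite locq_oppE locq_addE.
by apply: fracW; rewrite !mulNrn addNr !mul0rn.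
Qed.
HB.instance Definition _ := GRing.isZmodule.Build locq
  locq_addA locq_addC locq_add0 locq_addN.

Fact locq_mulA : associative locq_mul.
Proof.
move=> p q s; have [x [d ->]] := fracE p; have [y [e ->]] := fracE q.
have [z [f ->]] := fracE s; rewrite !locq_mulE.
by apply: fracW; rewrite /den_mul !prednK // mulrA; congr (_ *+ _); ring.
Qed.
Fact locq_mulC : commutative locq_mul.
Proof.
move=> p q; have [x [d ->]] := fracE p; have [y [e ->]] := fracE q.
by rewrite !locq_mulE mulrC /den_mul mulnC.
Qed.
Fact locq_mul1 : left_id (frac 1 0) locq_mul.
Proof.
move=> p; have [x [d ->]] := fracE p; rewrite locq_mulE.
by apply: fracW; rewrite /den_mul mul1n mul1r.
Qed.
Fact locq_mulDl : left_distributive locq_mul locq_add.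
Proof.
move=> p q s; have [x [d ->]] := fracE p; have [y [e ->]] := fracE q.
have [z [f ->]] := fracE s; rewrite !(locq_addE, locq_mulE).
apply: fracW; rewrite /den_mul !prednK // !mulrDl !mulrnDl !mulrnAl -!mulrnA.
by congr (_ *+ _ + _ *+ _); ring.
Qed.
HB.instance Definition _ := GRing.Zmodule_isComPzRing.Build locq
  locq_mulA locq_mulC locq_mul1 locq_mulDl.

Definition locq_of (x : A) : locq := frac x 0.

Lemma fracD x d y e :
  frac x d + frac y e = frac (x *+ e.+1 + y *+ d.+1) (den_mul d e).
Proof. exact: locq_addE. Qed.
Lemma fracN x d : - frac x d = frac (- x) d.
Proof. exact: locq_oppE. Qed.
Lemma fracM x d y e : frac x d * frac y e = frac (x * y) (den_mul d e).
Proof. exact: locq_mulE. Qed.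

Fact locq_of_is_zmod_morphism : zmod_morphism locq_of.
Proof. by move=> x y; rewrite /locq_of fracN fracD. Qed.
Fact locq_of_is_monoid_morphism : monoid_morphism locq_of.
Proof. by split=> // x y; rewrite /locq_of fracM. Qed.
HB.instance Definition _ :=
  GRing.isZmodMorphism.Build A locq locq_of locq_of_is_zmod_morphism.
HB.instance Definition _ :=
  GRing.isMonoidMorphism.Build A locq locq_of locq_of_is_monoid_morphism.
End LocQ.

Section RingOfIntegers.
Variable F : fieldExtType rat.

Definition integral_pred : {pred F} :=
  fun x => `[< integralOver (intr : int -> F) x >].

Fact integral_pred_subring : subring_closed integral_pred.
Proof.
split=> [|x y /asboolP ix /asboolP iy|x y /asboolP ix /asboolP iy];
  apply/asboolP; [exact: integral1|exact: integral_sub|exact: integral_mul].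
Qed.
HB.instance Definition _ :=
  GRing.isSubringClosed.Build F integral_pred integral_pred_subring.

Definition OF : Type := {x : F | x \in integral_pred}.
HB.instance Definition _ := SubChoice.on OF.
HB.instance Definition _ := [SubChoice_isSubComNzRing of OF by <:].

Definition OF_natural : set F := [set x | integralOver (intr : int -> F) x /\ x <> 0].

Lemma algebraic_int (x : F) :
  exists2 q : {poly int}, q != 0 & root (map_poly intr q) x.
Proof.
have /polyOver1P[p pE] := minPolyOver 1 x.
have [q [a a0 pq]] := rat_poly_scale p.
have p0 : p != 0.
  apply: contraTneq (monic_minPoly 1 x) => p0; rewrite pE p0 map_poly0.
  by rewrite monicE lead_coef0 eq_sym oner_eq0.
exists q; first by apply: contraNneq p0 => q0; rewrite pq q0 map_poly0 scaler0.
have := root_minPoly 1 x; rewrite pE pq map_polyZ -map_poly_comp /=.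
rewrite rootZ; last by rewrite scaler_eq0 negb_or invr_eq0 intr_eq0 a0 oner_eq0.
by rewrite (eq_map_poly (g := intr)) // => z /=; rewrite scaler_int.
Qed.

Lemma intrF_eq0 (b : int) : (b%:~R == 0 :> F) = (b == 0).
Proof. by rewrite -(rmorph_int (in_alg F)) fmorph_eq0 intr_eq0. Qed.

Lemma intrF_inj : injective (intr : int -> F).
Proof.
by move=> a b /eqP; rewrite -subr_eq0 -rmorphB intrF_eq0 subr_eq0 => /eqP.
Qed.

Lemma integral_lead_coefM (q : {poly int}) (x : F) : q != 0 ->
  root (map_poly intr q) x -> integralOver (intr : int -> F) ((lead_coef q)%:~R * x).
Proof.
move=> q0 rx; set c := lead_coef q; set n := (size q).-1.
have qn : size q = n.+1 by rewrite /n prednK // size_poly_gt0.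
have n0 : (0 < n)%N.
  rewrite lt0n; apply: contraTneq rx => n0.
  have /size_poly1P[b b0 ->] : size q == 1%N by rewrite qn n0.
  by rewrite map_polyC rootC intrF_eq0.
set P := \poly_(i < n) (q`_i * c ^+ (n.-1 - i)).
have sP : (size P < size ('X^n : {poly int})%R)%N.
  by rewrite size_polyXn ltnS size_poly.
exists ('X^n + P).
  by rewrite monicE lead_coefDl // lead_coefXn.
rewrite rmorphD /= map_polyXn /root hornerD hornerXn.
rewrite (@horner_coef_wide _ n); last first.
  by rewrite (leq_trans (size_poly _ _)) // size_poly.
move: rx; rewrite /root horner_coef size_map_inj_poly ?qn //; last exact: intrF_inj.
rewrite big_ord_recr /= => /eqP rx.
suff -> : (c%:~R * x) ^+ n + \sum_(i < n)
    (map_poly intr P)`_i * (c%:~R * x) ^+ i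
  = c%:~R ^+ n.-1 * (\sum_(i < n) (map_poly intr q)`_i * x ^+ i +
    (map_poly intr q)`_n * x ^+ n) :> F by rewrite rx mulr0.
rewrite addrC mulrDr mulr_sumr; congr (_ + _).
  apply: eq_bigr => i _; rewrite !coef_map /= coef_poly ltn_ord.
  rewrite rmorphM rmorphXn /= exprMn mulrACA -mulrA.
  rewrite -{2}(subnKC (_ : (i <= n.-1)%N)); last by rewrite -ltnS prednK.
  by rewrite exprD; ring.
rewrite coef_map /= -/n -[q`_n]/(lead_coef q) -/c exprMn mulrA -exprSr.
by rewrite prednK.
Qed.

Definition mkOF (x : F) (ix : integralOver (intr : int -> F) x) : OF :=
  exist _ x (asboolT ix).

Lemma fracOF (x : F) : exists ad : OF * nat, x *+ ad.2.+1 = val ad.1.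
Proof.
have [q q0 rx] := algebraic_int x; have := integral_lead_coefM q0 rx.
have : lead_coef q != 0 by rewrite lead_coef_eq0.
case: (lead_coef q) => n c0 ix.
  have iy : integralOver (intr : int -> F) (x *+ n) by rewrite -mulr_natl.
  exists (mkOF iy, n.-1); rewrite /= prednK // lt0n.
  by apply: contraNneq c0 => ->.
have iy : integralOver (intr : int -> F) (x *+ n.+1).
  by move/integral_opp: ix; rewrite NegzE rmorphN /= mulNr opprK -mulr_natl.
by exists (mkOF iy, n).
Qed.
End RingOfIntegers.

Section FiniteAdeles.
Variable F : fieldExtType rat.

(* A_f = \hat O_F tensor Q *)
Definition Af : Type := locq (hat (OF F)).
HB.instance Definition _ := TopComPzRing.on Af.

(* \hat O_F, as a subset of A_f *)
Definition Ohat : set Af := range (@locq_of (hat (OF F))).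

(* the embedding of F in A_f : a / d |-> a / d for a in O_F *)
Definition iota_f (x : F) : Af :=
  let: (a, d) := projT1 (cid (fracOF x)) in frac (hat_of a) d.

Lemma iota_fE (x : F) (a : OF F) (d : nat) : x *+ d.+1 = val a ->
  iota_f x = frac (hat_of a) d.
Proof.
rewrite /iota_f; case: (cid _) => -[b e] /= xb xa; apply: fracW.
by rewrite -!rmorphMn /=; congr hat_of; apply: val_inj; rewrite !rmorphMn /= -xa -xb mulrnAC.
Qed.

Fact iota_f_is_zmod_morphism : zmod_morphism iota_f.
Proof.
move=> x y; have [[a d] /= xa] := fracOF x; have [[b e] /= yb] := fracOF y.
rewrite (iota_fE xa) (iota_fE yb) fracN fracD.
rewrite -rmorphN -!rmorphMn -rmorphD; apply: iota_fE.
rewrite /den_mul prednK // rmorphD !rmorphMn rmorphN /= -xa -yb.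
by rewrite mulrnDl !mulNrn -!mulrnA [(e.+1 * d.+1)%N]mulnC.
Qed.
Fact iota_f_is_monoid_morphism : monoid_morphism iota_f.
Proof.
split; first exact: (@iota_fE 1 1 0).
move=> x y; have [[a d] /= xa] := fracOF x; have [[b e] /= yb] := fracOF y.
rewrite (iota_fE xa) (iota_fE yb) fracM -rmorphM; apply: iota_fE.
by rewrite /den_mul prednK // rmorphM /= -xa -yb mulrnAl mulrnAr -mulrnA mulnC.
Qed.
HB.instance Definition _ :=
  GRing.isZmodMorphism.Build F Af iota_f iota_f_is_zmod_morphism.
HB.instance Definition _ :=
  GRing.isMonoidMorphism.Build F Af iota_f iota_f_is_monoid_morphism.
End FiniteAdeles.


(* F_R = F tensor_Q R: with (e_i) the Q-basis vbasis fullv of F, the row vector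
   v stands for \sum_i e_i tensor v_i. *)
Section FReal.
Variables (F : fieldExtType rat) (R : realType).
Local Notation n := (\dim {:F}).
Local Notation e i := (vbasis {:F})`_i.

Definition FR : Type := 'rV[R]_n.
HB.instance Definition _ := Topological.on FR.
HB.instance Definition _ := GRing.Lmodule.on FR.

(* x |-> x tensor 1 *)
Definition iota_inf (x : F) : FR :=
  \row_k ratr (coord (vbasis {:F}) k x).

Definition FR_mul (v w : FR) : FR :=
  \sum_(i < n) \sum_(j < n) (v 0 i * w 0 j) *: iota_inf (e i * e j).

Fact iota_inf_is_zmod_morphism : zmod_morphism iota_inf.
Proof. by move=> x y; apply/rowP => k; rewrite !mxE linearB rmorphB. Qed.
HB.instance Definition _ :=
  GRing.isZmodMorphism.Build F FR iota_inf iota_inf_is_zmod_morphism.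

Lemma iota_infZ (a : rat) (x : F) : iota_inf (a *: x) = ratr a *: iota_inf x.
Proof. by apply/rowP => k; rewrite !mxE linearZ rmorphM. Qed.

Lemma iota_inf_basis (i j : 'I_n) : iota_inf (e i) 0 j = (i == j)%:R.
Proof.
by rewrite mxE coord_free ?rmorph_nat //; exact: basis_free (vbasisP _).
Qed.

Lemma FR_basis (v : FR) : v = \sum_(i < n) v 0 i *: iota_inf (e i).
Proof.
apply/rowP => k; rewrite summxE (bigD1 k) //= big1 => [|i ik].
  by rewrite mxE iota_inf_basis eqxx mulr1 addr0.
by rewrite mxE iota_inf_basis (negPf ik) mulr0.
Qed.

Lemma FR_mulDl (u v w : FR) : FR_mul (u + v) w = FR_mul u w + FR_mul v w.
Proof.
rewrite -big_split /=; apply: eq_bigr => i _; rewrite -big_split /=.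
by apply: eq_bigr => j _; rewrite mxE mulrDl scalerDl.
Qed.

Lemma FR_mulZl (a : R) (v w : FR) : FR_mul (a *: v) w = a *: FR_mul v w.
Proof.
rewrite scaler_sumr; apply: eq_bigr => i _; rewrite scaler_sumr.
by apply: eq_bigr => j _; rewrite mxE scalerA mulrA.
Qed.

Lemma FR_mulC : commutative FR_mul.
Proof.
move=> v w; rewrite /FR_mul exchange_big /=; apply: eq_bigr => i _.
by apply: eq_bigr => j _; rewrite mulrC [e j * _]mulrC.
Qed.

Lemma FR_mul0 (w : FR) : FR_mul 0 w = 0.
Proof. by rewrite -[X in FR_mul X _](scale0r (0 : FR)) FR_mulZl scale0r. Qed.

Lemma FR_mul_suml (I : Type) (s : seq I) (G : I -> FR) (w : FR) :
  FR_mul (\sum_(i <- s) G i) w = \sum_(i <- s) FR_mul (G i) w.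
Proof. exact: (big_morph (FR_mul^~ w) (fun u v => FR_mulDl u v w) (FR_mul0 w)). Qed.

Lemma FR_mul_iota (x : F) (w : FR) :
  FR_mul (iota_inf x) w = \sum_(j < n) w 0 j *: iota_inf (x * e j).
Proof.
rewrite /FR_mul exchange_big /=; apply: eq_bigr => j _.
rewrite [in RHS](coord_vbasis (memvf x)) mulr_suml raddf_sum scaler_sumr /=.
apply: eq_bigr => i _.
by rewrite -scalerAl iota_infZ scalerA [in LHS]mxE mulrC.
Qed.

Lemma iota_infM (x y : F) :
  iota_inf (x * y) = FR_mul (iota_inf x) (iota_inf y).
Proof.
rewrite FR_mul_iota [in LHS](coord_vbasis (memvf y)) mulr_sumr raddf_sum /=.
by apply: eq_bigr => i _; rewrite -scalerAr iota_infZ [in RHS]mxE.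
Qed.

Lemma FR_mul1 : left_id (iota_inf 1) FR_mul.
Proof.
move=> w; rewrite FR_mul_iota [RHS]FR_basis.
by apply: eq_bigr => i _; rewrite mul1r.
Qed.

Lemma FR_mulA : associative FR_mul.
Proof.
have A3 (u v w : FR) : FR_mul (FR_mul u v) w = \sum_(i < n) \sum_(j < n)
    \sum_(k < n) (u 0 i * v 0 j * w 0 k) *: iota_inf (e i * e j * e k).
  rewrite {2}/FR_mul FR_mul_suml; apply: eq_bigr => i _.
  rewrite FR_mul_suml; apply: eq_bigr => j _.
  rewrite FR_mulZl FR_mul_iota scaler_sumr.
  by apply: eq_bigr => k _; rewrite scalerA.
move=> u v w; rewrite FR_mulC !A3.
under [LHS]eq_bigr do rewrite exchange_big /=.
rewrite [LHS]exchange_big /=.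
apply: eq_bigr => i _; apply: eq_bigr => j _; apply: eq_bigr => k _.
by congr (_ *: iota_inf _); ring.
Qed.

HB.instance Definition _ := GRing.Zmodule_isComPzRing.Build FR
  FR_mulA FR_mulC FR_mul1 FR_mulDl.

Fact iota_inf_is_monoid_morphism : monoid_morphism iota_inf.
Proof. by split=> // x y; exact: iota_infM. Qed.
HB.instance Definition _ :=
  GRing.isMonoidMorphism.Build F FR iota_inf iota_inf_is_monoid_morphism.
End FReal.

Section BostConnes.
Variables (F : fieldExtType rat) (R : realType).
Local Open Scope group_scope.

Definition Fx : Type := units F.
HB.instance Definition _ := Group.on Fx.
Definition Afx : Type := units (Af F).
HB.instance Definition _ := Group.on Afx.
HB.instance Definition _ := Topological.on Afx.
Definition FRx : Type := units (FR F R).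
HB.instance Definition _ := Group.on FRx.
HB.instance Definition _ := Topological.on FRx.

(* the diagonal embeddings of F^* *)
Definition Fx_f : Fx -> Afx := umap (iota_f (F:=F)).
Definition Fx_inf : Fx -> FRx := umap (@iota_inf F R).

(* \hat O_F^*, as a subgroup of A_f^* *)
Definition Ohatx : set Afx := [set g | Ohat (uval g) /\ Ohat (uinv g)].

(* X_F = G(R) / G(R)^+ *)
Definition GRplus : set FRx := connected_component setT (1 : FRx).

Definition XF : Type :=
  tquot_by (fun z z' : FRx => exists2 c, GRplus c & z' = c * z).
HB.instance Definition _ := Topological.on XF.
HB.instance Definition _ := Quotient.on XF.

Definition XF_act (c : FRx) (z : XF) : XF := \pi_XF (c * repr z).

Lemma XF_actE (c z : FRx) : XF_act c (\pi_XF z) = \pi_XF (c * z).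
Proof.
have cP (x y : FRx) : (exists2 d, GRplus d & y = d * x) ->
    exists2 d, GRplus d & c * y = d * (c * x).
  by move=> [d Gd ->]; exists d => //; rewrite !mulgA [c * d]unitC.
exact: (quot_by_map cP (reprK (\pi_XF z))).
Qed.

Lemma XF_actM (c d : FRx) (z : XF) : XF_act (c * d) z = XF_act c (XF_act d z).
Proof. by rewrite -[XF_act d z]/(\pi_XF (d * repr z)) XF_actE mulgA. Qed.

(* The level K' quotient F^* \ (X_F x A_f^* ) / K', and Sh as their inverse
   limit over the compact open subgroups K' of A_f^*. *)
Record cosubgroup : Type := CoSubgroup {
  cosub : set Afx;
  cosub_compact : compact cosub;
  cosub_open : open cosub;
  cosub1 : cosub 1;
  cosubM : forall g h, cosub g -> cosub h -> cosub (g * h);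
  cosubV : forall g, cosub g -> cosub g^-1 }.

Definition Sh_rel (K : cosubgroup) (p q : XF * Afx) : Prop :=
  exists (x : Fx) (k : Afx),
    cosub K k /\ q = (XF_act (Fx_inf x) p.1, Fx_f x * p.2 * k).

Definition Sh_level (K : cosubgroup) : Type := tquot_by (Sh_rel K).
HB.instance Definition _ (K : cosubgroup) := Topological.on (Sh_level K).
HB.instance Definition _ (K : cosubgroup) := Quotient.on (Sh_level K).

Definition Sh_prod : Type := prod_topology Sh_level.
HB.instance Definition _ := Topological.on Sh_prod.

Definition Sh_coherent (s : Sh_prod) : Prop :=
  forall K L : cosubgroup, cosub K `<=` cosub L ->
  forall p, s K = \pi_(Sh_level K) p -> s L = \pi_(Sh_level L) p.

Definition Sh : Type := set_type Sh_coherent.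
HB.instance Definition _ := Topological.on Sh.

(* (c, h) . [z, l] = [c z, l h^-1] *)
Definition Sh_act_pair (c : FRx) (h : Afx) (p : XF * Afx) : XF * Afx :=
  (XF_act c p.1, p.2 * h^-1).

Lemma Sh_act_level (c : FRx) (h : Afx) (K : cosubgroup) (p q : XF * Afx) :
  p = q %[mod Sh_level K] ->
  Sh_act_pair c h p = Sh_act_pair c h q %[mod Sh_level K].
Proof.
apply: (@quot_by_map _ _ (Sh_rel K) (Sh_rel K)) => {p q} -[z l] _ [x [k [Kk ->]]].
exists x, k; split=> //.
by rewrite /Sh_act_pair /= -!XF_actM [c * _]unitC -!mulgA [k * _]unitC.
Qed.

Fact Sh_act_subproof (c : FRx) (h : Afx) (s : Sh) :
  Sh_coherent (fun K => \pi_(Sh_level K) (Sh_act_pair c h (repr (set_val s K)))).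
Proof.
move=> K L KL p /= sp; set q := repr (set_val s K).
have sL : set_val s L = \pi_(Sh_level L) q.
  by apply: (set_valP s K L KL); rewrite reprK.
transitivity (\pi_(Sh_level L) (Sh_act_pair c h q)).
  by apply: Sh_act_level; rewrite reprK.
apply: (@quot_by_map _ _ (Sh_rel K) (Sh_rel L) id) sp => p' _ [x [k [Kk ->]]].
by exists x, k; split=> //; exact: KL.
Qed.

Definition Sh_act (c : FRx) (h : Afx) (s : Sh) : Sh :=
  exist _ (_ : Sh_prod) (mem_set (@Sh_act_subproof c h s)).
End BostConnes.

Section Algebra.
Variables (F : fieldExtType rat) (R : realType).
(* ^o selects the topology of the modulus *)
Local Notation C := (R[i])^o.
Local Notation Sh := (Sh F R).
Local Notation Afx := (Afx F).
Local Notation FRx := (FRx F R).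
Local Notation Fx := (Fx F).

Lemma OhatM (a b : Af F) : Ohat a -> Ohat b -> Ohat (a * b).
Proof. by move=> [x _ <-] [y _ <-]; exists (x * y); rewrite ?rmorphM. Qed.

Lemma Ohat1 : Ohat (1 : Af F).
Proof. by exists 1; rewrite ?rmorph1. Qed.

(* Y_F = \hat O_F x Sh, as a subspace of A_f x Sh, and the partially defined
   action h . (rho, [z, l]) = (h rho, [z, l h^-1]) of A_f^* on it. *)
Definition YF : set (Af F * Sh) := [set y | Ohat y.1].

Definition YF_act (h : Afx) (y : Af F * Sh) : Af F * Sh :=
  (uval h * y.1, Sh_act 1%g h y.2).

Definition UF_set : set (Afx * (Af F * Sh)) :=
  [set u | YF u.2 /\ YF (YF_act u.1 u.2)].
Definition UF : Type := set_type UF_set.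
HB.instance Definition _ := Topological.on UF.

Definition mkUF (g : Afx) (y : Af F * Sh) (gy : UF_set (g, y)) : UF :=
  exist _ (g, y) (mem_set gy).

(* Z_F, the quotient of U_F by the action
   (g1, g2) . (g, y) = (g1 g g2^-1, g2 y) of (\hat O_F^* )^2. *)
Definition ZF_rel (u v : UF) : Prop :=
  exists g1 g2 : Afx, [/\ Ohatx g1, Ohatx g2 &
    set_val v =
      ((g1 * (set_val u).1 * g2^-1)%g, YF_act g2 (set_val u).2)].

Definition ZF : Type := tquot_by ZF_rel.
HB.instance Definition _ := Topological.on ZF.
HB.instance Definition _ := Quotient.on ZF.

(* H_F = C_c(Z_F), as a space of functions on U_F *)
Definition HF : set (UF -> C) :=
  [set f | exists phi : ZF -> C,
     [/\ continuous phi, compact (closure [set z | phi z != 0]) &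
         f = phi \o \pi_ZF]].

(* the convolution product of H_F; the summand depends only on the coset of h *)
Definition UF_ext (f : UF -> C) (u : Afx * (Af F * Sh)) : C :=
  if pselect (UF_set u) is left Uu then f (exist _ u (mem_set Uu)) else 0.

Definition Ohatx_coset : Type :=
  quot_by (fun h h' : Afx => exists2 g, Ohatx g & h' = (g * h)%g).
HB.instance Definition _ := Choice.on Ohatx_coset.
HB.instance Definition _ := Quotient.on Ohatx_coset.

Definition conv (f1 f2 : UF -> C) (u : UF) : C :=
  let: (g, y) := set_val u in
  \sum_(q \in [set q : Ohatx_coset | YF (YF_act (repr q) y)])
    UF_ext f1 ((g * (repr q)^-1)%g, YF_act (repr q) y) *
    UF_ext f2 (repr q, y).

(* Sym, the semigroup of pairs (m, c) with m in \hat O_F and in A_f^*, and c in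
   F_R^* *)
Definition Sym_set : set (Afx * FRx) := [set s | Ohat (uval s.1)].
Definition Sym : Type := set_type Sym_set.
HB.instance Definition _ := Choice.on Sym.

Definition sym_f (s : Sym) : Afx := (set_val s).1.
Definition sym_inf (s : Sym) : FRx := (set_val s).2.

Lemma sym_Ohat (s : Sym) : Ohat (uval (sym_f s)).
Proof. exact: (set_valP s). Qed.

Definition mk_sym (m : Afx) (c : FRx) (om : Ohat (uval m)) : Sym :=
  exist _ (m, c) (mem_set (om : Sym_set (m, c))).

Definition sym_one : Sym := mk_sym 1%g (Ohat1 : Ohat (uval (1%g : Afx))).

Definition sym_mul (s t : Sym) : Sym :=
  mk_sym (m := (sym_f s * sym_f t)%g) (sym_inf s * sym_inf t)%g
    (OhatM (sym_Ohat s) (sym_Ohat t)).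

Lemma symP (s t : Sym) : sym_f s = sym_f t -> sym_inf s = sym_inf t -> s = t.
Proof.
move: s t => [[m c] p] [[m' c'] p']; rewrite /sym_f /sym_inf /= => mm cc.
by apply: val_inj; rewrite /= mm cc.
Qed.

Fact sym_mulA : associative sym_mul.
Proof. by move=> s t u; apply: symP; exact: mulgA. Qed.
Fact sym_mul1 : left_id sym_one sym_mul.
Proof. by move=> s; apply: symP; exact: mul1g. Qed.
Fact sym_mulr1 : right_id sym_one sym_mul.
Proof. by move=> s; apply: symP; exact: mulg1. Qed.
HB.instance Definition _ := isMonoid.Build Sym sym_mulA sym_mul1 sym_mulr1.

(* theta_(m,c) f (g, rho, [z, l]) = f (g, rho m, [c z, l]) *)
Definition sym_act_pair (s : Sym) (u : Afx * (Af F * Sh)) :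
    Afx * (Af F * Sh) :=
  (u.1, (u.2.1 * uval (sym_f s), Sh_act (sym_inf s) 1%g u.2.2)).

Fact sym_act_subproof (s : Sym) (u : UF) :
  UF_set (sym_act_pair s (set_val u)).
Proof.
have [ou ogu] := set_valP u; split; rewrite /YF /=.
  exact: OhatM ou (sym_Ohat s).
by rewrite mulrA; exact: OhatM ogu (sym_Ohat s).
Qed.

Definition theta (s : Sym) (f : UF -> C) : UF -> C :=
  fun u => f (mkUF (sym_act_subproof s u)).

(* Inn = F^* cap \hat O_F, embedded diagonally in Sym *)
Definition Inn : set Fx := [set x | Ohat (iota_f (uval x))].

Definition inn_sym (x : set_type Inn) : Sym :=
  mk_sym (Fx_inf R (set_val x)) (set_valP x : Ohat (uval (Fx_f (set_val x)))).

Definition Out : Type :=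
  quot_by (fun s t : Sym => exists x, t = (inn_sym x * s)%g).
HB.instance Definition _ := Choice.on Out.
HB.instance Definition _ := Quotient.on Out.

Definition adeles : Type := (Af F * FR F R)%type.
HB.instance Definition _ := TopComPzRing.on adeles.
Definition ideles : Type := units adeles.
HB.instance Definition _ := Group.on ideles.
HB.instance Definition _ := Topological.on ideles.

Fact mk_idele_subproof (m : Afx) (c : FRx) :
  ((uval m, uval c) : adeles) * (uinv m, uinv c) = 1.
Proof. by congr (_, _); exact: uvalK. Qed.
Definition mk_idele (m : Afx) (c : FRx) : ideles :=
  mk_unit (mk_idele_subproof m c).

Definition idele_classes : Type :=
  tquot_by (fun a b : ideles =>
    exists x : Fx, b = (mk_idele (Fx_f x) (Fx_inf R x) * a)%g).
HB.instance Definition _ := Topological.on idele_classes.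
HB.instance Definition _ := Quotient.on idele_classes.

Definition sym_pi0 (s : Sym) : pi0 idele_classes :=
  \pi_(pi0 idele_classes)
    (\pi_idele_classes (mk_idele (sym_f s) (sym_inf s))).

Definition out_pi0 (o : Out) : pi0 idele_classes := sym_pi0 (repr o).
End Algebra.

Arguments YF : clear implicits.
Arguments HF : clear implicits.
Arguments OF_natural : clear implicits.
Arguments Inn : clear implicits.
Arguments inn_sym {F} R x.

(* Main.v *)
From HB Require Import structures.
Require Import Defs.
From mathcomp Require Import all_boot all_order all_algebra all_field.
From mathcomp Require Import all_classical all_reals all_analysis.
From mathcomp Require Import complex.
From Stdlib Require Import Relation_Operators.
Set Implicit Arguments.
Unset Strict Implicit.
Unset Printing Implicit Defensive.
Import Order.TTheory GRing.Theory Num.Theory.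
Import numFieldNormedType.Exports.
Local Open Scope quotient_scope.
Local Open Scope classical_set_scope.
Local Open Scope ring_scope.

(** An element x of F lies in \hat O_F exactly when it is integral: if x = a/d
    with a in O_F, comparing a with d times an element of \hat O_F modulo a
    multiple of d shows that d divides a in O_F ([Ohat_iota_f]). This gives
    Inn = O_F \ {0}. The class of s in pi_0 of the idele classes is unchanged
    when s is multiplied by an element of Inn, since Inn is embedded diagonally.

    For the action, let (m, c) and (m', c') have the same image in pi_0. For
    each open subgroup K of A_f^*, the product K x F_R^{*,+} is an open subgroup
    of the ideles, so the sets F^* a (K x F_R^{*,+}) partition the ideles into
    open, hence clopen, pieces, and the image of each piece in the idele class
    group is a union of connected components. Therefore
         (m', c') = x (m, c) (k, d),   x in F^*, k in K, d in F_R^{*,+}     (1)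
    ([pi0_idele_classes]). Here F_R^{*,+}, the component of 1 in F_R^*, is open
    because a small ball around 1 in F_R is a convex set of units on which
    inversion is continuous ([open_GRplus]).

    Take K = \hat O_F^* in (1), open by [open_Ohatx], and write x_0, k_0 for the
    resulting elements and x_0 = n / n' with n, n' in Inn. Then
    n' m' = k_0 n m, and acting by (k_0, k_0) in (\hat O_F^* )^2 takes
    (g, rho n m, [n c z, l]) to (g, rho n' m', [n c z, l k_0^-1]). It remains to
    see that [n c z, l k_0^-1] = [n' c' z, l] in Sh. This may be checked at each
    level L, where (1) with K = L gives x and k, and the element x / x_0 of F^*
    together with k in L carries the first pair to the second ([Sh_act_eq]).
    Functions in H_F are invariant under (\hat O_F^* )^2, so
    theta_(n s) = theta_(n' s') on H_F. *)

(** * Topology of unit groups *)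

Section UnitsTopology.
Variable A : topComPzRingType.
Implicit Types u v w : units A.

Lemma units_val_continuous : continuous (set_val : units A -> A * A).
Proof. exact: initial_continuous. Qed.

Lemma uval_continuous : continuous (@uval A).
Proof.
move=> u; apply: continuous_comp; first exact: units_val_continuous.
exact: cvg_fst.
Qed.

Lemma uinv_continuous : continuous (@uinv A).
Proof.
move=> u; apply: continuous_comp; first exact: units_val_continuous.
exact: cvg_snd.
Qed.

Lemma units_continuous_at (T : topologicalType) (f : T -> units A) t :
  {for t, continuous (@uval A \o f)} -> {for t, continuous (@uinv A \o f)} ->
  {for t, continuous f}.
Proof.
move=> cv ci U /= [_ [[W oW <-] Wft WU]].
have : nbhs (set_val (f t)) W by exact: open_nbhs_nbhs.
rewrite [set_val _]surjective_pairing => nW.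
have cP : (uval (f z), uinv (f z)) @[z --> t] --> (uval (f t), uinv (f t)).
  exact: cvg_pair cv ci.
rewrite nbhs_simpl /=.
apply: (@filterS _ _ _ (fun z => W (uval (f z), uinv (f z)))); last exact: cP.
by move=> z Wz; apply: WU; rewrite /= [set_val _]surjective_pairing.
Qed.

(* Only separate continuity of the multiplication is needed, as only
   translations by fixed units are used. *)
Hypothesis mulA : forall a : A, continuous (fun x : A => a * x).

Lemma unit_mull_continuous w : continuous (fun u => (w * u)%g).
Proof.
move=> u; apply: units_continuous_at.
  apply: (@continuous_comp _ _ _ (@uval A) (fun x => uval w * x)).
    exact: uval_continuous.
  exact: mulA.
apply: (@continuous_comp _ _ _ (@uinv A) (fun x => uinv w * x)).
  exact: uinv_continuous.
exact: mulA.
Qed.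

Lemma open_coset w (H : set (units A)) : open H -> open [set u | H (w * u)%g].
Proof.
by move=> oH; apply: open_comp oH => u _; exact: unit_mull_continuous.
Qed.

Lemma component_mull w u v : connected_component setT u v ->
  connected_component setT (w * u)%g (w * v)%g.
Proof.
move=> [C [Cu _ cC] Cv]; exists [set (w * x)%g | x in C]; last by exists v.
split=> //; first by exists u.
apply: connected_continuous_connected cC _.
by apply: continuous_subspaceT => x; exact: unit_mull_continuous.
Qed.

Lemma component1M u v : connected_component setT (1 : units A)%g u ->
  connected_component setT (1 : units A)%g v ->
  connected_component setT (1 : units A)%g (u * v)%g.
Proof.
move=> cu cv; apply: connected_component_trans cu _.
by have := component_mull u cv; rewrite mulg1.
Qed.

Lemma component1V u : connected_component setT (1 : units A)%g u ->
  connected_component setT (1 : units A)%g u^-1%g.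
Proof.
move=> cu; apply: connected_component_sym.
by have := component_mull u^-1%g cu; rewrite mulg1 mulVg.
Qed.

(** The component of 1 is open as soon as it is a neighbourhood of 1. *)
Lemma open_component1 (B : set (units A)) : open B -> B 1%g ->
  B `<=` connected_component setT (1 : units A)%g ->
  open (connected_component setT (1 : units A)%g).
Proof.
move=> oB B1 sB; rewrite openE => u cu.
apply: filterS (_ : [set v | B (u^-1 * v)%g] `<=` _) _.
  by move=> v /sB cv; have := component1M cu cv; rewrite mulgA mulgV mul1g.
by apply: open_nbhs_nbhs; split; [exact: open_coset|rewrite /= mulVg].
Qed.
End UnitsTopology.

Section UnitsMapMorphism.
Variables (A B : comPzRingType) (f : {rmorphism A -> B}).

Lemma umapM (u v : units A) : umap f (u * v)%g = (umap f u * umap f v)%g.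
Proof. by apply: uval_inj; exact: rmorphM. Qed.

Lemma umap1 : umap f 1%g = 1%g.
Proof. by apply: uval_inj; exact: rmorph1. Qed.

Lemma umapV (u : units A) : umap f u^-1%g = (umap f u)^-1%g.
Proof. exact: uval_inj. Qed.
End UnitsMapMorphism.

Section UnitsMap.
Variables (A B : topComPzRingType) (f : {rmorphism A -> B}).

Lemma umap_continuous : continuous f -> continuous (umap f).
Proof.
move=> cf u; apply: units_continuous_at.
  apply: (@continuous_comp _ _ _ (@uval A) f); last exact: cf.
  exact: uval_continuous.
apply: (@continuous_comp _ _ _ (@uinv A) f); last exact: cf.
exact: uinv_continuous.
Qed.
End UnitsMap.

Lemma continuous_prod_map (S T U V : topologicalType)
    (f : S -> U) (g : T -> V) :
  continuous f -> continuous g ->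
  continuous (fun p : S * T => (f p.1, g p.2)).
Proof.
move=> cf cg p; apply: cvg_pair => /=.
  by apply: (@continuous_comp _ _ _ fst f); [exact: cvg_fst|exact: cf].
by apply: (@continuous_comp _ _ _ snd g); [exact: cvg_snd|exact: cg].
Qed.

Lemma clopen_component (T : topologicalType) (W : set T) x y : clopen W ->
  connected_component setT x y -> W x -> W y.
Proof.
move=> [oW cW] [C [Cx _ cC] Cy] Wx.
suff CW : C `&` W = C by move: Cy; rewrite -CW => -[].
by apply: cC; [exists x|exists W|exists W].
Qed.

Lemma clopen_pi0 (T : topologicalType) (W : set T) (x y : T) : clopen W ->
  x = y %[mod pi0 T] -> W x -> W y.
Proof.
move=> coW /quot_byP xy; suff : W x <-> W y by case.
elim: xy => {x y} [x y xy|//|x y _ xy|x y z _ -> _ ->] //; last first.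
  by case: xy; split.
by split; apply: clopen_component => //; exact: connected_component_sym.
Qed.

Section DoubleCosets.
Variable A : topComPzRingType.
Hypothesis mulA : forall a : A, continuous (fun x : A => a * x).
Variables D U : set (units A).
Hypotheses (DM : forall d e, D d -> D e -> D (d * e)%g).
Hypotheses (DV : forall d, D d -> D d^-1%g).
Hypotheses (UM : forall u v, U u -> U v -> U (u * v)%g).
Hypotheses (UV : forall u, U u -> U u^-1%g).
Hypothesis (oU : open U).

(** The set D a U, for subgroups D and U of the commutative group A^*: those b
    for which some (d a)^-1 b lies in U. *)
Definition double_coset (a : units A) : set (units A) :=
  [set b | exists2 d, D d & U ((d * a)^-1 * b)%g].

Lemma open_double_coset a : open (double_coset a).
Proof.
rewrite [double_coset a](_ : _ =
    \bigcup_(d in D) [set b | U ((d * a)^-1 * b)%g]); last first.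
  by apply/seteqP; split=> b [d Dd dU]; exists d.
by apply: bigcup_open => d _; exact: open_coset.
Qed.

Lemma double_coset_trans a b c :
  double_coset a c -> double_coset b c -> double_coset a b.
Proof.
move=> [d Dd Ud] [e De Ue]; exists (e^-1 * d)%g; first exact: DM (DV De) Dd.
have -> : ((e^-1 * d * a)^-1 * b = ((d * a)^-1 * c) * ((e * b)^-1 * c)^-1)%g.
  by rewrite !invgM !invgK !mulgA -(mulgA _ c) mulgV mulg1.
exact: UM Ud (UV Ue).
Qed.

Hypotheses (D1 : D 1%g) (U1 : U 1%g).

(** The double cosets partition A^*, and each of them is open because U is. *)
Lemma clopen_double_coset a : clopen (double_coset a).
Proof.
split; first exact: open_double_coset.
rewrite -openC openE => b nab; apply: (@filterS _ _ _ (double_coset b)).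
  by move=> c bc ac; apply: nab; exact: double_coset_trans ac bc.
apply: open_nbhs_nbhs; split; first exact: open_double_coset.
by exists 1%g; rewrite ?mul1g ?mulVg.
Qed.
End DoubleCosets.

(** * The component of 1 in the archimedean unit group *)

Section EntrywiseContinuity.
Variables (R : realType) (T : topologicalType).

Lemma continuous_at_mx m n (f : T -> 'M[R]_(m, n)) t :
  (forall i j, {for t, continuous (fun x => f x i j)}) -> {for t, continuous f}.
Proof.
move=> cf U /= [P nP PU]; rewrite nbhs_simpl /=.
apply: (@filterS _ _ _ [set x | forall i j, P i j (f x i j)]).
  by move=> x Px; exact: PU.
by apply: filter_forall => i; apply: filter_forall => j; apply: cf; exact: nP.
Qed.

Lemma continuous_det n (f : T -> 'M[R]_n) :
  (forall i j, continuous (fun x => f x i j)) ->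
  continuous (fun x => \det (f x)).
Proof.
move=> cf; apply: continuous_big => [|s _]; first exact: add_continuous.
move=> x; apply: cvgM; first exact: cvg_cst.
by apply: continuous_big => [|i _]; [exact: mul_continuous|exact: cf].
Qed.

Lemma continuous_adj n (f : T -> 'M[R]_n) :
  (forall i j, continuous (fun x => f x i j)) ->
  forall i j, continuous (fun x => (\adj (f x)) i j).
Proof.
move=> cf i j.
have -> : (fun x => (\adj (f x)) i j) =
    (fun x => (-1) ^+ (j + i) * \det (row' j (col' i (f x)))).
  by apply/funext => x; rewrite mxE.
move=> x; apply: cvgM; first exact: cvg_cst.
apply: continuous_det => k l.
rewrite (_ : (fun _ => _) = (fun x => f x (lift j k) (lift i l))) //.
by apply/funext => y; rewrite !mxE.
Qed.

Lemma continuous_mulmx m n p (f : T -> 'M[R]_(m, n)) (g : T -> 'M[R]_(n, p)) :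
  (forall i j, continuous (fun x => f x i j)) ->
  (forall i j, continuous (fun x => g x i j)) ->
  forall i j, continuous (fun x => (f x *m g x) i j).
Proof.
move=> cf cg i j.
have -> : (fun x => (f x *m g x) i j) = (fun x => \sum_k f x i k * g x k j).
  by apply/funext => x; rewrite mxE.
apply: continuous_big => [|k _]; first exact: add_continuous.
by move=> x; apply: cvgM; [exact: cf|exact: cg].
Qed.

(** By Cramer's rule, the solution v of v M = u is continuous at each
    invertible M. *)
Lemma continuous_solve n (f : T -> 'M[R]_n) (u : 'rV[R]_n) t :
  (forall i j, continuous (fun x => f x i j)) -> \det (f t) != 0 ->
  {for t, continuous (fun x => (\det (f x))^-1 *: (u *m \adj (f x)))}.
Proof.
move=> cf ft0; apply: continuous_at_mx => i j.
rewrite (_ : (fun _ => _) =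
    (fun x => (\det (f x))^-1 * (u *m \adj (f x)) i j)); last first.
  by apply/funext => x; rewrite mxE.
apply: cvgM; first by apply: cvgV => //; exact: continuous_det.
apply: continuous_mulmx => k l; first exact: cst_continuous.
exact: continuous_adj.
Qed.
End EntrywiseContinuity.

Section ArchimedeanUnits.
Variables (F : fieldExtType rat) (R : realType).
Local Notation FR := (FR F R).
Local Notation n := (\dim {:F}).

Definition mulFR (v : FR) (w : 'rV[R]_n) : 'rV[R]_n := (w : FR) * v.

Fact mulFR_linear v : linear (mulFR v).
Proof.
move=> a w w'; rewrite /mulFR mulrDl; congr (_ + _); exact: FR_mulZl.
Qed.
HB.instance Definition _ (v : FR) :=
  GRing.isLinear.Build R 'rV[R]_n 'rV[R]_n *:%R (mulFR v) (mulFR_linear v).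

(** The matrix of w |-> w v in the basis of F_R, acting on row vectors. *)
Definition mulFR_mx (v : FR) : 'M[R]_n := lin1_mx (mulFR v).

Lemma mulFR_mxE (w v : FR) : w * v = (w : 'rV[R]_n) *m mulFR_mx v.
Proof. by rewrite mul_rV_lin1. Qed.

Lemma FR_coord_continuous i j : continuous (fun v : FR => (v : 'rV[R]_n) i j).
Proof. exact: coord_continuous. Qed.

Lemma FR_mull_continuous (v : FR) : continuous (fun w : FR => v * w).
Proof.
move=> w; apply: continuous_at_mx => i j.
rewrite (_ : (fun _ => _) = (fun w : FR => ((w : 'rV[R]_n) *m mulFR_mx v) i j)).
  apply: (@continuous_mulmx _ FR _ _ _ (fun w => (w : 'rV[R]_n))) => k l.
    exact: FR_coord_continuous.
  exact: cst_continuous.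
by apply/funext => x; rewrite mulrC mulFR_mxE.
Qed.

Lemma mulFR_mx_continuous i j : continuous (fun v : FR => mulFR_mx v i j).
Proof.
rewrite (_ : (fun _ => _) =
  (fun v : FR => ((v : 'rV[R]_n) *m mulFR_mx (delta_mx 0 i : 'rV[R]_n)) 0 j)).
  apply: (@continuous_mulmx _ FR _ _ _ (fun w => (w : 'rV[R]_n))) => k l.
    exact: FR_coord_continuous.
  exact: cst_continuous.
by apply/funext => v; rewrite mxE -mulFR_mxE mulrC.
Qed.

(** The inverse of v in F_R, as the solution w of w v = 1 by Cramer's rule; it
    is meaningful when multiplication by v has nonzero determinant. *)
Definition FR_inv (v : FR) : FR :=
  (\det (mulFR_mx v))^-1 *: ((1 : FR) *m \adj (mulFR_mx v)).

Lemma FR_mulV (v : FR) : \det (mulFR_mx v) != 0 -> v * FR_inv v = 1.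
Proof.
move=> v0; rewrite mulrC mulFR_mxE -scalemxAl -mulmxA mul_adj_mx.
by rewrite mul_mx_scalar scalerA mulVf // scale1r.
Qed.

Lemma FR_inv_continuous (v : FR) : \det (mulFR_mx v) != 0 ->
  {for v, continuous FR_inv}.
Proof.
move=> v0; apply: (@continuous_solve _ FR _ mulFR_mx) => // i j.
exact: mulFR_mx_continuous.
Qed.

Lemma det_mulFR_mx1 : \det (mulFR_mx 1) != 0.
Proof.
rewrite (_ : mulFR_mx 1 = 1%:M) ?det1 ?oner_eq0 //.
by apply/row_matrixP => i; rewrite !rowE -mulFR_mxE mulr1 mulmx1.
Qed.

(** The elements of F_R whose multiplication matrix is invertible. *)
Definition regFR : set FR := [set v | \det (mulFR_mx v) != 0].

Lemma open_regFR : open regFR.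
Proof.
rewrite -[regFR]/((fun v : FR => \det (mulFR_mx v)) @^-1` [set x | x != 0]).
apply: open_comp; last exact: open_neq.
move=> v _; apply: (@continuous_det _ FR _ mulFR_mx) => i j.
exact: mulFR_mx_continuous.
Qed.

(** The unit with value v, for v in [regFR]; the default value 1 elsewhere. *)
Definition unitFR (v : FR) : FRx F R :=
  if pselect (regFR v) is left v0 then mk_unit (FR_mulV v0) else 1%g.

Lemma unitFRK (v : FR) : regFR v -> uval (unitFR v) = v.
Proof. by rewrite /unitFR; case: pselect. Qed.

Lemma uinv_unitFR (v : FR) : regFR v -> uinv (unitFR v) = FR_inv v.
Proof. by rewrite /unitFR; case: pselect. Qed.

Lemma unitFR_continuous (v : FR) : regFR v -> {for v, continuous unitFR}.
Proof.
move=> v0; have nv : nbhs v regFR.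
  by apply: open_nbhs_nbhs; split => //; exact: open_regFR.
apply: (@units_continuous_at _ _ unitFR) => U /=;
  rewrite ?unitFRK ?uinv_unitFR //.
  move=> nU; rewrite nbhs_simpl /=; apply: filterS2 nv nU => w w0 Uw.
  by rewrite /= unitFRK.
move=> /(FR_inv_continuous v0) /= nU; rewrite nbhs_simpl /=.
by apply: filterS2 nv nU => w w0 Uw; rewrite /= uinv_unitFR.
Qed.

(** A ball of units around 1 lies in the component of 1, because a segment from
    1 to a point of the ball stays in the ball and lifts to a path of units. *)
Lemma open_GRplus : open (@GRplus F R).
Proof.
have /nbhs_ballP[e /= e0 eP] : nbhs ((1 : FR) : 'rV[R]_n) regFR.
  by apply: open_nbhs_nbhs; split; [exact: open_regFR|exact: det_mulFR_mx1].
apply: (@open_component1 _ FR_mull_continuous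
  (@uval FR @^-1` (ball ((1 : FR) : 'rV[R]_n) e)°)).
- by apply: open_comp (open_interior _) => u _; exact: uval_continuous.
- exact: nbhsx_ballx.
move=> u /= /interior_subset uB.
pose p (t : R) : FR := (1 : FR) + t *: (uval u - 1).
have pB t : t \in `[0, 1] -> regFR (p t).
  rewrite in_itv /= => /andP[t0 t1]; apply: eP; split=> // i j.
  case: uB => _ /(_ i j); rewrite /ball /= !mxE opprD addrA subrr sub0r normrN.
  rewrite normrM ger0_norm // => ue; apply: le_lt_trans ue.
  by rewrite distrC ler_piMl.
have I0 : (0 : R) \in `[0, 1] by rewrite in_itv /= lexx ler01.
have I1 : (1 : R) \in `[0, 1] by rewrite in_itv /= lexx ler01.
have p0 : p 0 = 1 by rewrite /p scale0r addr0.
have p1 : p 1 = uval u by rewrite /p scale1r addrC subrK.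
exists [set unitFR (p t) | t in `[0, 1]]; last first.
  by exists 1 => //; apply: uval_inj; rewrite unitFRK; [exact: p1|exact: pB].
split=> //.
  by exists 0 => //; apply: uval_inj; rewrite unitFRK; [exact: p0|exact: pB].
apply: connected_continuous_connected; first exact: segment_connected.
apply: continuous_in_subspaceT => t /set_mem /= tI.
apply: (@continuous_comp _ _ _ p unitFR); last first.
  by apply: unitFR_continuous; exact: pB.
apply: continuous_at_mx => i j.
rewrite (_ : (fun _ => _) = fun s => (1 : FR) i j + s * (uval u - 1 : FR) i j).
  by apply: cvgD; [exact: cvg_cst|apply: cvgM; [exact: cvg_id|exact: cvg_cst]].
by apply/funext => s; rewrite !mxE.
Qed.
End ArchimedeanUnits.

(** * Divisibility and topology in the completion *)

Section HatDivisibility.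
Variable A : comPzRingType.

Lemma pi_modqMn n (a : A) k : \pi_(modq A n) (a *+ k) = \pi_(modq A n) a *+ k.
Proof.
elim: k => [|k IH]; first by rewrite !mulr0n.
by rewrite !mulrS pi_modqD IH.
Qed.

Lemma hprojMn n (x : hat A) k : hproj n (x *+ k) = hproj n x *+ k.
Proof.
elim: k => [|k IH]; first by rewrite !mulr0n.
by rewrite !mulrS -IH.
Qed.

Hypothesis torsion_free : forall n, injective (fun a : A => a *+ n.+1).

(** The kernel of the projection to A / (N+1)A is (N+1) times the completion. *)
Lemma hat_divisible N (y : hat A) : hproj N y = 0 -> exists z, y = z *+ N.+1.
Proof.
move=> yN; pose M k := den_mul N k; pose a k := repr (hproj (M k) y).
have ME k : (M k).+1 = (N.+1 * k.+1)%N by rewrite /M /den_mul prednK.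
have aE k m : (m.+1 %| (M k).+1)%N -> hproj m y = \pi_(modq A m) (a k).
  by move=> mk; exact: hat_repr.
(* A lift a_k of y modulo (N+1)(k+1) is a multiple of N+1, and, as A is torsion
   free, its quotient b_k is determined modulo k+1 by y. *)
have /choice[b bE] k : exists b, a k = b *+ N.+1.
  have : 0 = a k %[mod modq A N] by rewrite -aE ?yN // ME dvdn_mulr.
  by move=> /modqP[b ->]; exists b; rewrite add0r.
have cb : coherent (fun k => \pi_(modq A k) (b k)).
  move=> m n mn c /(modq_sub mn) <-.
  have MM : ((M m).+1 %| (M n).+1)%N by rewrite !ME dvdn_pmul2l.
  have : a m = a n %[mod modq A (M m)] by rewrite -!aE.
  move=> /modqP[c']; rewrite !bE ME mulnC mulrnA -mulrnDl => /torsion_free bb.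
  by apply/modqP; exists c'.
exists (mk_hat cb); apply: hatP => k; rewrite hprojMn.
by rewrite (aE k) ?ME ?dvdn_mull // bE pi_modqMn.
Qed.
End HatDivisibility.

Section HatTopology.
Variable A : comPzRingType.

Lemma hproj_continuous n :
  continuous (@hproj A n : hat A -> discrete_topology (modq A n)).
Proof.
move=> x; apply: (@continuous_comp _ _ _
  (set_val : hat A -> modq_prod A) (fun f => f n)).
  exact: initial_continuous.
exact: (@proj_continuous _ (fun n => discrete_topology (modq A n))).
Qed.

Lemma nbhs_hproj n (x : hat A) : nbhs x [set x' | hproj n x' = hproj n x].
Proof.
apply: (@hproj_continuous n x [set p | p = hproj n x]).
by apply: open_nbhs_nbhs; split => //; exact: discrete_open.
Qed.

Lemma hat_mull_continuous (y : hat A) : continuous (fun x : hat A => y * x).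
Proof.
apply: continuous_comp_initial => x.
apply/cvg_sup; first exact/fmap_filter/(nbhs_filter (x : hat A)).
move=> n U [V [[W oW <-]]] WV VU.
rewrite nbhs_simpl /=.
apply: (@filterS _ _ _ [set x' | hproj n x' = hproj n x]).
  move=> x' xx'; apply: VU => /=; move: WV => /=.
  by rewrite -[set_val (y * x') n]/(hproj n y * hproj n x') xx'.
exact: nbhs_hproj.
Qed.
End HatTopology.

(** * Finite adeles *)

Section FiniteAdeles.
Variable F : fieldExtType rat.
Local Notation Af := (Af F).
Local Notation OF := (OF F).
Local Notation frac := (@Defs.frac _).
Local Notation hatO := (hat OF).

Lemma F_mulrn_inj n : injective (fun x : F => x *+ n.+1).
Proof.
move=> x y /eqP; rewrite -subr_eq0 -mulrnBl -mulr_natl mulf_eq0.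
rewrite -(rmorph_nat (in_alg F)) fmorph_eq0 pnatr_eq0 /= subr_eq0.
by move/eqP.
Qed.

Lemma OF_mulrn_inj n : injective (fun a : OF => a *+ n.+1).
Proof.
move=> a b /(congr1 val); rewrite !rmorphMn => /F_mulrn_inj ab.
exact: val_inj.
Qed.

Lemma OhatD (a b : Af) : Ohat a -> Ohat b -> Ohat (a + b).
Proof. by move=> [x _ <-] [y _ <-]; exists (x + y); rewrite ?rmorphD. Qed.

Lemma frac_mulrn (z : hatO) d : frac (z *+ d.+1) d = locq_of z.
Proof. by apply: fracW; rewrite mulr1n. Qed.

(** Whether x / (d+1) lies in \hat O_F only depends on x modulo d+1; this is why
    \hat O_F is open in A_f. *)
Lemma Ohat_frac_hproj (x x' : hatO) d : hproj d x' = hproj d x ->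
  Ohat (frac x d : Af) -> Ohat (frac x' d : Af).
Proof.
move=> xx' ox.
have [z zE] : exists z, x' - x = z *+ d.+1.
  apply: (hat_divisible OF_mulrn_inj).
  by rewrite -[LHS]/(hproj d x' - hproj d x) xx' subrr.
have -> : frac x' d = frac x d + locq_of z :> Af.
  rewrite -(frac_mulrn z d) -zE; apply/esym; rewrite fracD.
  apply: fracW; rewrite -mulrnDl addrC subrK -mulrnA.
  by rewrite /den_mul prednK.
by apply: OhatD => //; exists z.
Qed.

Lemma open_Ohat : open (@Ohat F).
Proof.
suff oO : open ((\pi_Af : hatO * nat -> Af) @^-1` @Ohat F) by exact: oO.
rewrite openE => -[x d] ox.
exists ([set x' | hproj d x' = hproj d x], [set d]).
  split => /=; first exact: nbhs_hproj.
  by apply: open_nbhs_nbhs; split=> //; exact: discrete_open.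
by move=> [x' d'] /= [xx' ->]; exact: Ohat_frac_hproj xx' ox.
Qed.

Lemma Af_mull_continuous (a : Af) : continuous (fun b : Af => a * b).
Proof.
have [y [e ->]] := fracE a.
apply/(@quotient_continuous _ (quot_by (@locq_rel hatO))).
have -> : (fun b : Af => frac y e * b) \o \pi_Af =
    \pi_Af \o (fun p : hatO * nat => (y * p.1, den_mul e p.2)).
  by apply/funext => -[x d]; exact: fracM.
move=> p; apply: continuous_comp; last exact: pi_continuous.
apply: (@continuous_prod_map _ _ _ _ (fun x : hatO => y * x) (den_mul e)).
  exact: hat_mull_continuous.
by apply/continuousP => U _; exact: discrete_open.
Qed.

Lemma open_Ohatx : open (@Ohatx F).
Proof.
apply: (@openI _ (@uval Af @^-1` @Ohat F) (@uinv Af @^-1` @Ohat F)).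
  by apply: open_comp open_Ohat => u _; exact: uval_continuous.
by apply: open_comp open_Ohat => u _; exact: uinv_continuous.
Qed.

(** F meets \hat O_F in O_F. *)
Lemma Ohat_iota_f (x : F) :
  Ohat (iota_f x) <-> integralOver (intr : int -> F) x.
Proof.
split=> [|ix]; last first.
  by exists (hat_of (mkOF ix)) => //; apply/esym/iota_fE.
have [[a d] /= xa] := fracOF x; rewrite (iota_fE xa) => -[z _ /fracP[t]].
(* The equality a (t+1) = z (d+1) (t+1) in the completion is read modulo
   (d+1) (t+1), where its right-hand side vanishes. *)
set M := (d.+1 * t.+1).-1; have ME : M.+1 = (d.+1 * t.+1)%N by rewrite prednK.
move=> /(congr1 (hproj M)); rewrite mulr1n -mulrnA -ME !hprojMn.
rewrite (modqE (hproj M z)) -!pi_modqMn => /modqP[c].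
rewrite -mulrnDl ME mulrnA => /OF_mulrn_inj aE.
have -> : x = val (repr (hproj M z) + c).
  by apply: (@F_mulrn_inj d); rewrite xa aE; exact: (rmorphMn (val : OF -> F)).
by have /asboolP := valP (repr (hproj M z) + c).
Qed.
End FiniteAdeles.

(** * Connected components of the idele class group *)

Section IdeleClasses.
Variables (F : fieldExtType rat) (R : realType).
Local Notation FR := (FR F R).
Local Notation Af := (Af F).
Local Notation ideles := (ideles F R).
Local Notation adeles := (adeles F R).

(** The finite and archimedean parts of an idele. *)
Definition idele_f : ideles -> Afx F := umap (fst : adeles -> Af).
Definition idele_inf : ideles -> FRx F R := umap (snd : adeles -> FR).

Lemma idele_f_continuous : continuous idele_f.
Proof. by apply: umap_continuous => p; exact: cvg_fst. Qed.

Lemma idele_inf_continuous : continuous idele_inf.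
Proof. by apply: umap_continuous => p; exact: cvg_snd. Qed.

Lemma idele_fM (a b : ideles) :
  idele_f (a * b)%g = (idele_f a * idele_f b)%g.
Proof. exact (umapM _ a b). Qed.

Lemma idele_infM (a b : ideles) :
  idele_inf (a * b)%g = (idele_inf a * idele_inf b)%g.
Proof. exact (umapM _ a b). Qed.

Lemma idele_f1 : idele_f 1%g = 1%g.
Proof. exact (umap1 _). Qed.

Lemma idele_inf1 : idele_inf 1%g = 1%g.
Proof. exact (umap1 _). Qed.

Lemma idele_fV (a : ideles) : idele_f a^-1%g = (idele_f a)^-1%g.
Proof. exact (umapV _ a). Qed.

Lemma idele_infV (a : ideles) : idele_inf a^-1%g = (idele_inf a)^-1%g.
Proof. exact (umapV _ a). Qed.

Lemma GRplusM (c d : FRx F R) : GRplus c -> GRplus d -> GRplus (c * d)%g.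
Proof. exact: (component1M (@FR_mull_continuous F R)). Qed.

Lemma GRplusV (c : FRx F R) : GRplus c -> GRplus c^-1%g.
Proof. exact: (component1V (@FR_mull_continuous F R)). Qed.

(** The diagonal embedding of F^* in the ideles. *)
Definition idele_of (x : Fx F) : ideles := mk_idele (Fx_f x) (Fx_inf R x).

Lemma adele_mull_continuous (a : adeles) : continuous (fun b : adeles => a * b).
Proof.
apply: (@continuous_prod_map _ _ _ _
  (fun x : Af => a.1 * x) (fun x : FR => a.2 * x)).
  exact: Af_mull_continuous.
exact: FR_mull_continuous.
Qed.

(** Equality in pi_0(F^* \ A_F^* ) forces equality in
    F^* \ A_F^* / (K x F_R^{*,+}) for each open subgroup K of A_f^*. *)
Lemma pi0_idele_classes (K : set (Afx F)) (m m' : Afx F) (c c' : FRx F R) :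
  open K -> K 1%g -> (forall g h, K g -> K h -> K (g * h)%g) ->
  (forall g, K g -> K g^-1%g) ->
  \pi_(idele_classes F R) (mk_idele m c) =
    \pi_(idele_classes F R) (mk_idele m' c') %[mod pi0 (idele_classes F R)] ->
  exists x k d, [/\ K k, GRplus d, m' = (Fx_f x * m * k)%g &
    c' = (Fx_inf R x * c * d)%g].
Proof.
move=> oK K1 KM KV mcE.
pose U := idele_f @^-1` K `&` idele_inf @^-1` @GRplus F R.
have oU : open U.
  apply: openI; apply: open_comp => //; last exact: open_GRplus.
    by move=> *; exact: idele_f_continuous.
  by move=> *; exact: idele_inf_continuous.
pose D := range idele_of.
have DM d e : D d -> D e -> D (d * e)%g.
  move=> [x _ <-] [y _ <-]; exists (x * y)%g => //.
  by apply: uval_inj; congr (_, _); exact: rmorphM.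
have DV d : D d -> D d^-1%g.
  by move=> [x _ <-]; exists x^-1%g => //; exact: uval_inj.
have D1 : D 1%g.
  by exists 1%g => //; apply: uval_inj; congr (_, _); exact: rmorph1.
have UM u v : U u -> U v -> U (u * v)%g.
  move=> [Ku cu] [Kv cv]; split; rewrite /preimage /mkset ?idele_fM ?idele_infM.
    exact: KM.
  exact: GRplusM.
have UV u : U u -> U u^-1%g.
  move=> [Ku cu]; split; rewrite /preimage /mkset ?idele_fV ?idele_infV.
    exact: KV.
  exact: GRplusV.
have U1 : U 1%g.
  split; first by rewrite /preimage /mkset idele_f1.
  by rewrite /preimage /mkset idele_inf1; exact: connected_component_refl.
pose S := double_coset D U (mk_idele m c).
have [oS cS] : clopen S.
  exact: (clopen_double_coset adele_mull_continuous DM DV UM UV oU D1 U1).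
have SD x b : S b -> S (idele_of x * b)%g.
  move=> [d Dd Ub]; exists (idele_of x * d)%g.
    by apply: DM => //; exists x.
  by rewrite -mulgA invgM -mulgA mulKg.
have SE b b' : b = b' %[mod idele_classes F R] -> S b -> S b'.
  move=> /tquot_byP bb; suff : S b <-> S b' by case.
  elim: bb => {b b'} [b b' [x ->]|//|b b' _ [] //|b b' b'' _ -> _ -> //].
  split; first exact: SD.
  move=> /(SD x^-1%g); rewrite mulgA.
  rewrite [(idele_of _ * _)%g](_ : _ = 1%g) ?mul1g //.
  by apply: uval_inj; congr (_, _); rewrite -rmorphM mulrC uvalK rmorph1.
pose W := [set q : idele_classes F R | S (repr q)].
have WE : \pi_(idele_classes F R) @^-1` W = S.
  by apply/seteqP; split=> b; apply: SE; rewrite reprK.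
have coW : clopen W.
  split; first by rewrite /open /= /quotient_open WE.
  by rewrite -openC; move: cS; rewrite -WE -openC.
have : S (mk_idele m' c').
  rewrite -WE; apply: (clopen_pi0 coW mcE).
  rewrite -[W _]/((\pi_(idele_classes F R) @^-1` W) _) WE.
  by exists 1%g; rewrite ?mul1g ?mulVg.
move=> [_ [x _ <-]]; set u := (_ * _)%g => -[Ku cu].
have uE : mk_idele m' c' = (idele_of x * mk_idele m c * u)%g.
  by rewrite /u mulgA mulgV mul1g.
exists x, (idele_f u), (idele_inf u); split=> //.
  transitivity (idele_f (mk_idele m' c')); first exact: uval_inj.
  by rewrite uE !idele_fM; congr (_ * _ * _)%g; exact: uval_inj.
transitivity (idele_inf (mk_idele m' c')); first exact: uval_inj.
by rewrite uE !idele_infM; congr (_ * _ * _)%g; exact: uval_inj.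
Qed.
End IdeleClasses.

(** * The action on the Shimura variety *)

Section ShimuraAction.
Variables (F : fieldExtType rat) (R : realType).
Local Notation Afx := (Afx F).
Local Notation FRx := (FRx F R).
Local Notation Fx := (Fx F).

Lemma Sh_actM (c c' : FRx) (h h' : Afx) (s : Sh F R) :
  Sh_act c h (Sh_act c' h' s) = Sh_act (c * c')%g (h' * h)%g s.
Proof.
apply: val_inj; apply: functional_extensionality_dep => L /=.
set p := repr (set_val s L).
transitivity (\pi_(Sh_level R L) (Sh_act_pair c h (Sh_act_pair c' h' p))).
  by apply: Sh_act_level; rewrite reprK.
congr \pi_(Sh_level R L); rewrite /Sh_act_pair /= -XF_actM -mulgA -invgM.
by rewrite [(h * h')%g]unitC.
Qed.

Lemma XF_act_GRplus (c d : FRx) (z : XF F R) : GRplus d ->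
  XF_act (c * d)%g z = XF_act c z.
Proof.
move=> Gd; rewrite -[z]reprK !XF_actE; apply/esym/tquot_byP/rst_step.
by exists d => //; rewrite [(c * d)%g]unitC mulgA.
Qed.

(** Two elements of F_R^* x A_f^* act in the same way on Sh if at each level L
    they agree up to F^*, F_R^{*,+} and L. *)
Lemma Sh_act_eq (c c' : FRx) (h h' : Afx) (s : Sh F R) :
  (forall L : cosubgroup F, exists x k d, [/\ cosub L k, GRplus d,
    (h'^-1 = Fx_f x * h^-1 * k)%g & (c' = Fx_inf R x * c * d)%g]) ->
  Sh_act c h s = Sh_act c' h' s.
Proof.
move=> hP; apply: val_inj; apply: functional_extensionality_dep => L /=.
have [x [k [d [Lk Gd hE cE]]]] := hP L.
apply/tquot_byP/rst_step; exists x, k; split=> //.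
rewrite /Sh_act_pair /= cE XF_act_GRplus // XF_actM hE; congr (_, _).
by rewrite !mulgA; congr (_ * _ * _)%g; exact: unitC.
Qed.

Lemma Fx_fM (x y : Fx) : Fx_f (x * y)%g = (Fx_f x * Fx_f y)%g.
Proof. exact (umapM _ x y). Qed.

Lemma Fx_infM (x y : Fx) : Fx_inf R (x * y)%g = (Fx_inf R x * Fx_inf R y)%g.
Proof. exact (umapM _ x y). Qed.

Lemma Fx_fV (x : Fx) : Fx_f x^-1%g = (Fx_f x)^-1%g.
Proof. exact (umapV _ x). Qed.

(** F^* is the group of fractions of Inn. *)
Lemma Inn_ratio (x : Fx) : exists n n' : Fx,
  [/\ Inn F n, Inn F n' & n = (x * n')%g].
Proof.
have [[a d] /= xa] := fracOF (uval x).
have d0 : d.+1%:R != 0 :> F.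
  by rewrite -[_%:R]/(d.+1%:~R) intrF_eq0.
pose n' : Fx := mk_unit (mulfV d0).
exists (x * n')%g, n'; split=> //; apply/Ohat_iota_f.
  have -> : uval (x * n')%g = val a.
    by transitivity (uval x *+ d.+1); [exact: mulr_natr|exact: xa].
  by have /asboolP := valP a.
have -> : uval n' = d.+1%:R by [].
exact: integral_nat.
Qed.
End ShimuraAction.

Theorem proposition7p3p3 (R : realType) (F : fieldExtType rat) :
  [/\ [set uval x | x in Inn F] = OF_natural F,
      forall s : Sym F R, out_pi0 (\pi_(Out F R) s) = sym_pi0 s
    & forall s s' : Sym F R, sym_pi0 s = sym_pi0 s' ->
        exists n n' : set_type (Inn F), forall f, HF F R f ->
          theta (inn_sym R n * s)%g f = theta (inn_sym R n' * s')%g f].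
Proof.
split.
- apply/seteqP; split=> [_ [x Ix <-]|x [ix x0]].
    split; first exact/Ohat_iota_f.
    by move=> x0; have /eqP := uvalK x; rewrite x0 mul0r eq_sym oner_eq0.
  have {}x0 : x != 0 by apply/eqP.
  by exists (mk_unit (mulfV x0)) => //; exact/Ohat_iota_f.
- move=> s; have : repr (\pi_(Out F R) s) = s %[mod Out F R] by rewrite reprK.
  move=> /quot_byP; rewrite /out_pi0.
  move: (repr _) => t.
  elim=> {s t} [t _ [x ->]|//|t u _ ->//|t u v _ -> _ -> //].
  congr (\pi_(pi0 (idele_classes F R)) _); apply/tquot_byP/rst_step.
  by exists (set_val x); exact: uval_inj.
move=> s s' ss'.
have sP (K : set (Afx F)) : open K -> K 1%g ->
    (forall g h, K g -> K h -> K (g * h)%g) -> (forall g, K g -> K g^-1%g) ->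
  exists x k d, [/\ K k, GRplus d, sym_f s' = (Fx_f x * sym_f s * k)%g &
    sym_inf s' = (Fx_inf R x * sym_inf s * d)%g].
  by move=> oK K1 KM KV; exact: pi0_idele_classes oK K1 KM KV ss'.
have [|||x0 [k0 [d0 [Kk0 _ mE0 _]]]] := sP (@Ohatx F) (@open_Ohatx F).
- by split; exact: Ohat1.
- by move=> g h [g1 g2] [h1 h2]; split; exact: OhatM.
- by move=> g [g1 g2]; split.
(* The elements x0 and k0 determine n, n' and the element of (\hat O_F^* )^2
   used below; they do not depend on the level. *)
have [n [n' [In In' nE]]] := Inn_ratio x0.
exists (exist _ n (mem_set In)), (exist _ n' (mem_set In')) => f.
move=> [phi [_ _ ->]]; apply/funext => u.
have mE : (Fx_f n' * sym_f s' = k0 * (Fx_f n * sym_f s))%g.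
  by rewrite mE0 nE Fx_fM [RHS]unitC !mulgA [(Fx_f n' * Fx_f x0)%g]unitC.
rewrite /theta /=; congr phi; apply/tquot_byP/rst_step.
(* As A_f^* is commutative, (k0, k0) fixes g. *)
exists k0, k0; split=> //.
rewrite /= /sym_act_pair /YF_act /=; congr (_, (_, _)).
- by rewrite [(k0 * _)%g]unitC -mulgA mulgV mulg1.
- transitivity ((set_val u).2.1 * uval (Fx_f n' * sym_f s')%g) => //.
  by rewrite mE; exact: mulrCA.
rewrite Sh_actM; apply/esym/Sh_act_eq => L.
have [x [k [d [Lk Gd mxE cE]]]] := sP (cosub L) (cosub_open L) (cosub1 L)
   (@cosubM _ L) (@cosubV _ L).
(* Both sides are the quotient of the finite parts of s' and s. *)
have xk : (Fx_f x0 * k0 = Fx_f x * k)%g.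
  apply: (@mulgI _ (sym_f s)).
  by rewrite !mulgA ![(sym_f s * _)%g]unitC -mE0 -mxE.
exists (x * x0^-1)%g, k, d; split=> //.
  rewrite Fx_fM mul1g -(mulgA (Fx_f x)) Fx_fV -invgM.
  by rewrite [(k0 * _)%g]unitC xk -mulgA [(_^-1 * k)%g]unitC mulgA mulgV invg1.
transitivity (Fx_inf R n' * sym_inf s')%g => //.
transitivity
  (Fx_inf R (x * x0^-1)%g * (Fx_inf R n * sym_inf s) * d)%g; last first.
  by rewrite mul1g.
rewrite cE nE !mulgA -Fx_infM -[in RHS]Fx_infM; congr (Fx_inf R _ * _ * _)%g.
by rewrite mulgA -[(x / x0 * x0)%g]mulgA mulVg mulg1 unitC.
Qed.
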